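(* Let $t \geq 2$ be an integer and let $H$ be any connected graph with more than $t$ vertices. Then, as $r \to \infty$, \[ f(r,H) \leq (1 + o_r(1))\, \frac{r-1}{t-1}. \]
   Context: Let $r,k$ be positive integers. A graph $G$ is an $(r,k)$-graph if $V(G)$ can be partitioned into sets $V_1,\dots,V_r$ with $|V_i| \le k$ for all $i$ such that for every pair $i \neq j$ in $[r]$ there is an edge of $G$ with one endpoint in $V_i$ and the other in $V_j$. For a graph $H$, $f(r,H)$ is the minimum $k$ such that there exists an $H$-free $(r,k)$-graph. $o_r(1)$ denotes a quantity tending to $0$ as $r \to \infty$ (with $t$ and $H$ fixed). *)

(* Defs.v *)
From HB Require Import structures.
From mathcomp Require Import all_boot.

Set Implicit Arguments.
Unset Strict Implicit.
Unset Printing Implicit Defensive.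

Record sgraph := SGraph {
  vertex :> finType;
  adj : rel vertex;
  adj_sym : symmetric adj;
  adj_irrefl : irreflexive adj
}.

Definition connected_graph (G : sgraph) : Prop :=
  0 < #|G| /\ forall x y : G, connect (@adj G) x y.

(* Subgraph containment is not required to be induced. *)
Definition contains_subgraph (H G : sgraph) : Prop :=
  exists2 h : H -> G, injective h & forall x y : H, adj x y -> adj (h x) (h y).

Definition free_of (H G : sgraph) : Prop := ~ contains_subgraph H G.

(* Parts are indexed by 'I_r, so that the number of parts is r even if some
   part is empty (the edge condition excludes empty parts as soon as r >= 2). *)
Definition rk_graph (r k : nat) (G : sgraph) : Prop :=
  [/\ 0 < r, 0 < k &
   exists V : 'I_r -> {set G},
    [/\ \bigcup_(i < r) V i = [set: G],
        forall i j : 'I_r, i != j -> [disjoint V i & V j],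
        forall i : 'I_r, #|V i| <= k
      & forall i j : 'I_r, i != j ->
          exists x y : G, [/\ x \in V i, y \in V j & adj x y]]].

Definition free_rk_graph_exists (r k : nat) (H : sgraph) : Prop :=
  exists2 G : sgraph, rk_graph r k G & free_of H G.

(* The graph of the partial function f: f_is r H k reads "f(r, H) = k".  A
   relation needs no default value when no H-free (r, k)-graph exists, so
   asserting f_is also asserts that the minimum exists. *)
Definition f_is (r : nat) (H : sgraph) (k : nat) : Prop :=
  free_rk_graph_exists r k H /\
  forall k' : nat, free_rk_graph_exists r k' H -> k <= k'.

Lemma f_is_unique (r : nat) (H : sgraph) (k k' : nat) :
  f_is r H k -> f_is r H k' -> k = k'.
Proof.
by move=> [e m] [e' m']; apply/eqP; rewrite eqn_leq m ?m'.
Qed.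

(* Main.v *)
Require Import Defs.
From HB Require Import structures.
From mathcomp Require Import all_boot all_order all_algebra.
From mathcomp Require Import all_classical all_reals all_analysis.
From mathcomp Require Import zify ring lra.
Import Order.TTheory GRing.Theory Num.Theory.
Import numFieldNormedType.Exports.
Set Implicit Arguments.
Unset Strict Implicit.
Unset Printing Implicit Defensive.
Local Open Scope classical_set_scope.
Local Open Scope ring_scope.

(** A disjoint union of cliques on at most [t] vertices contains no connected
    graph with more than [t] vertices.  Such a union is an [(r, k)]-graph as
    soon as its cliques come from blocks of size at most [t] that cover all
    pairs of an [r]-set and have at most [k] blocks through each point.  Let
    [D r] be the least such [k].  If [q] is prime to [(t - 1)!], the lines
    [x = a i + b] over [Z/q] cover all pairs of points of [{0..t-1} * Z/q] with
    distinct first coordinates, using [q] lines through each point; covering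
    the [t] columns recursively gives [D (t q) <= q + D q].  Any [r] is at most
    such a [t q] with [q <= r / t + O(1)], and [r / (t - 1)] solves the
    recursion [D r = r / t + D (r / t)]. *)

(** Blocks are indexed by [B], so repetitions are allowed; [k], the bound on the blocks through a
    point, becomes the part size. *)
Definition pair_cover (t : nat) (T : finType) (k : nat) : Prop :=
  exists (B : finType) (block : B -> {set T}),
    [/\ forall b, (#|block b| <= t)%N,
        forall i j, i != j -> exists b, (i \in block b) && (j \in block b)
      & forall i, (\sum_(b : B) (i \in block b) <= k)%N].

Lemma pair_cover_monotone t (T : finType) k k' :
  (k <= k')%N -> pair_cover t T k -> pair_cover t T k'.
Proof.
move=> le_kk' [B [block [cB pB dB]]]; exists B, block; split=> // i.
exact: leq_trans (dB i) le_kk'.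
Qed.

Lemma pair_cover_all_pairs t (T : finType) :
  (2 <= t)%N -> pair_cover t T (#|T| * #|T|).
Proof.
move=> t2; exists (T * T)%type, (fun p => [set p.1; p.2]%SET); split.
- by move=> p; rewrite cards2; apply: leq_trans t2; case: (_ != _).
- by move=> i j _; exists (i, j); rewrite !inE !eqxx orbT.
- move=> i; rewrite -card_prod -sum1_card; apply: leq_sum => p _.
  exact: leq_b1.
Qed.

Lemma pair_cover_inj t (T U : finType) (f : T -> U) k :
  injective f -> pair_cover t U k -> pair_cover t T k.
Proof.
move=> f_inj [B [block [cB pB dB]]].
exists B, (fun b => f @^-1: block b)%SET; split.
- move=> b; apply: leq_trans (cB b); rewrite -(card_imset _ f_inj).
  by apply/subset_leq_card/fintype.subsetP => _ /imsetP[x + ->]; rewrite inE.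
- move=> i j neq_ij; have [|b /andP[ib jb]] := pB (f i) (f j).
    by apply: contra_neq neq_ij => /f_inj.
  by exists b; rewrite !inE ib jb.
- move=> i; apply: leq_trans (dB (f i)); apply: leq_sum => b _.
  by rewrite inE.
Qed.

(** For points in distinct columns the slope is found by dividing by the unit [g i - g j]. A point
    lies on one line of each slope, hence on [#|A|] lines. Pairs within a column are left to a copy
    of the cover of [A] there. *)
Lemma pair_cover_lines t (A : finComUnitRingType) (g : 'I_t -> A) k :
    (forall i j, i != j -> g i - g j \is a GRing.unit) ->
  pair_cover t A k -> pair_cover t ('I_t * A)%type (#|A| + k).
Proof.
move=> g_unit [B [block [cB pB dB]]].
pose bl (c : (A * A) + ('I_t * B)) : {set 'I_t * A} := match c with
  | inl l => [set (i, l.1 * g i + l.2) | i : 'I_t]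
  | inr d => [set (d.1, x) | x in block d.2] end%SET.
have bl_line i x l : ((i, x) \in bl (inl l)) = (x == l.1 * g i + l.2).
  apply/imsetP/eqP => [[j _ [-> ->]] //|->]; by exists i.
have bl_col i x d : ((i, x) \in bl (inr d)) = (i == d.1) && (x \in block d.2).
  apply/imsetP/andP => [[y yb [-> ->]]|[/eqP-> xb]]; first by rewrite eqxx.
  by exists x.
exists ((A * A) + ('I_t * B))%type, bl; split.
- case=> [l|d]; apply: leq_trans (leq_imset_card _ _) _ => //.
  by rewrite card_ord.
- move=> [i x] [j y] neq_p; have [eq_ij|neq_ij] := eqVneq i j.
    subst j; have [|b /andP[xb yb]] := pB x y.
      by apply: contra_neq neq_p => ->.
    by exists (inr (i, b)); rewrite !bl_col eqxx xb yb.
  pose a := (x - y) / (g i - g j).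
  exists (inl (a, x - a * g i)); rewrite !bl_line /=.
  have da : a * (g i - g j) = x - y by rewrite divrK // g_unit.
  apply/andP; split; apply/eqP; first by ring.
  have -> : a * g j + (x - a * g i) = x - a * (g i - g j) by ring.
  by rewrite da; ring.
- move=> [i x]; rewrite big_sumType leq_add //.
    under eq_bigr => l _ do rewrite bl_line.
    rewrite -(pair_bigA _ (fun a b => nat_of_bool (x == a * g i + b))) /=.
    rewrite -sum1_card; apply: leq_sum => a _.
    rewrite (bigD1 (x - a * g i)) //= big1 ?addn0 ?leq_b1 // => b neq_b.
    apply/eqP; rewrite eqb0; apply: contra neq_b => /eqP->.
    by apply/eqP; ring.
  under eq_bigr => d _ do rewrite bl_col.
  rewrite -(pair_bigA _ (fun j b => nat_of_bool ((i == j) && (x \in block b)))).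
  rewrite (bigD1 i) //= eqxx [X in (_ + X)%N]big1 ?addn0 ?dB //.
  by move=> j; rewrite eq_sym => /negPf->; apply: big1.
Qed.

Lemma pair_cover_ord_step t q r k :
    (1 < q)%N -> coprime q (t.-1)`! -> (r <= t * q)%N ->
  pair_cover t 'I_q k -> pair_cover t 'I_r (q + k).
Proof.
move=> q1 co_q le_r cov_q.
have cardZ : #|'Z_q| = q by rewrite card_ord Zp_cast.
have [f f_inj] : exists f : 'Z_q -> 'I_q, injective f.
  by exists (cast_ord (Zp_cast q1)); apply: cast_ord_inj.
pose g (i : 'I_t) : 'Z_q := i%:R.
have g_lt (i j : 'I_t) : (j < i)%N -> g i - g j \is a GRing.unit.
  move=> lt_ji; rewrite -natrB 1?ltnW // unitZpE //.
  apply: coprime_dvdr co_q; apply: dvdn_fact.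
  have := ltn_ord i; lia.
have g_unit (i j : 'I_t) : i != j -> g i - g j \is a GRing.unit.
  rewrite neq_ltn => /orP[lt_ij|]; last exact: g_lt.
  by rewrite -opprB unitrN g_lt.
have := pair_cover_lines g_unit (pair_cover_inj f_inj cov_q).
rewrite cardZ.
have le_card : (r <= #|{: 'I_t * 'Z_q}|)%N by rewrite card_prod card_ord cardZ.
apply: (pair_cover_inj (f := fun i => enum_val (widen_ord le_card i))).
by move=> i j /enum_val_inj /(congr1 val) /= eq_ij; apply: val_inj.
Qed.

(** The slack of a factor [1 + 1/m] absorbs the rounding of [r / t] up to an admissible [q], so the
    same [C] survives every level of the recursion. *)
Lemma pair_cover_asymptotic t m : (2 <= t)%N ->
  exists C, forall r, exists2 k, pair_cover t 'I_r k &
    (m * t.-1 * k <= m.+1 * r + C)%N.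
Proof.
move=> t2; pose F := (t.-1)`!; have F0 : (0 < F)%N by apply: fact_gt0.
pose r0 := ((m * t).+1 * (t * F.+1)).+1.
(* This constant pays for the cover by all pairs when [r < r0]. *)
exists (m * t.-1 * (r0 * r0))%N; elim/ltn_ind => r IH.
have [lt_r|le_r] := ltnP r r0.
  exists (r * r)%N.
    by have := pair_cover_all_pairs 'I_r t2; rewrite card_ord.
  by rewrite (leq_trans _ (leq_addl _ _)) // leq_mul2l leq_mul ?orbT // ltnW.
(* [q] is 1 modulo [F], hence coprime to it, and exceeds [r / t] by at most [F.+1]. *)
pose s := (r %/ (t * F)).+1; pose q := (F * s).+1.
have tF0 : (0 < t * F)%N by rewrite muln_gt0 F0 andbT; lia.
have q1 : (1 < q)%N by rewrite ltnS muln_gt0 F0.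
have co_q : coprime q F.
  by rewrite coprime_sym /coprime /q -addn1 mulnC gcdnMDl gcdn1.
have le_rq : (r <= t * q)%N.
  have := ltn_ceil r tF0; rewrite -/s /q; clearbody s; nia.
have le_qr : (t * q <= r + t * F.+1)%N.
  have := leq_divM r (t * F); rewrite /q /s; set d := (r %/ _)%N.
  by clearbody d F; nia.
have le_2r : (2 * r <= t * r)%N by rewrite leq_mul2r t2 orbT.
have lt_qr : (q < r)%N.
  rewrite -(ltn_pmul2l (_ : 0 < t)%N); last by lia.
  apply: leq_ltn_trans le_qr _.
  have : (t * F.+1 < r)%N by apply: leq_trans le_r; rewrite ltnS leq_pmull.
  by move: (t * _)%N => c; lia.
have [k cov_k le_k] := IH q lt_qr.
exists (q + k)%N; first exact: pair_cover_ord_step cov_k.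
(* Adding [m * t.-1 * q] to the induction bound [m.+1 * q + C] gives [(m * t).+1 * q + C]. Since
   [t * q <= r + t * F.+1], the claim reduces to [(m * t).+1 * (t * F.+1) <= t.-1 * r], which [r0]
   ensures. *)
suff : ((m * t).+1 * q <= m.+1 * r)%N.
  move: le_k; move: (m * t.-1 * (r0 * r0))%N => C.
  by clearbody q; case: (t) t2 => // u _ /=; lia.
rewrite -(leq_pmul2l (_ : 0 < t)%N); last by lia.
have : ((m * t).+1 * (t * q) <= (m * t).+1 * (r + t * F.+1))%N.
  by rewrite leq_mul2l le_qr orbT.
move: le_r; rewrite /r0; clearbody q; move: (t * F.+1)%N => c; lia.
Qed.

(** A point gets a separate vertex in each block through it, which makes the cliques disjoint. *)
Definition flag (T B : finType) (block : B -> {set T}) := {p : T * B | p.1 \in block p.2}.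

Definition flag_adj (T B : finType) (block : B -> {set T}) : rel (flag block) :=
  fun x y => ((val x).2 == (val y).2) && ((val x).1 != (val y).1).

Lemma flag_adj_sym (T B : finType) (block : B -> {set T}) :
  symmetric (@flag_adj T B block).
Proof. by move=> x y; rewrite /flag_adj eq_sym [X in _ && ~~ X]eq_sym. Qed.

Lemma flag_adj_irrefl (T B : finType) (block : B -> {set T}) :
  irreflexive (@flag_adj T B block).
Proof. by move=> x; rewrite /flag_adj !eqxx. Qed.

Definition block_graph (T B : finType) (block : B -> {set T}) : sgraph :=
  SGraph (@flag_adj_sym T B block) (@flag_adj_irrefl T B block).

(** Edges stay inside a block, so a connected image lies over a single block, and its vertices are
    told apart by their points. *)
Lemma block_graph_free (T B : finType) (block : B -> {set T})
    t (H : sgraph) :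
    (forall b, (#|block b| <= t)%N) -> connected_graph H -> (t < #|H|)%N ->
  free_of H (block_graph block).
Proof.
move=> cB [/card_gt0P[x0 _] conn] ltH [h h_inj h_adj].
pose b0 := (val (h x0)).2.
have hb x : (val (h x)).2 = b0.
  have /connectP[p path_p ->] := conn x0 x; rewrite /b0.
  elim: p (x0) path_p => //= y p IHp z /andP[/h_adj/andP[/eqP-> _]].
  exact: IHp.
have inj1 : injective (fun x => (val (h x)).1).
  move=> x y eq_xy; apply/h_inj/val_inj.
  have := hb x; rewrite -(hb y).
  by move: eq_xy; case: (val (h x)) (val (h y)) => [? ?] [? ?] /= -> ->.
have : (#|H| <= #|block b0|)%N.
  rewrite -(card_codom inj1); apply/subset_leq_card/fintype.subsetP.
  by move=> _ /codomP[x ->]; rewrite -(hb x) (valP (h x)).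
by move=> /leq_trans/(_ (cB b0)); rewrite leqNgt ltH.
Qed.

(** Part [i] consists of the flags over the point [i]; a block containing [i] and [j] supplies the
    edge between their parts. *)
Lemma pair_cover_free_rk_graph t (H : sgraph) r k :
    connected_graph H -> (t < #|H|)%N -> (0 < r)%N -> (0 < k)%N ->
  pair_cover t 'I_r k -> free_rk_graph_exists r k H.
Proof.
move=> conn ltH r0 k0 [B [block [cB pB dB]]].
exists (block_graph block); last exact: block_graph_free cB conn ltH.
split=> //; exists (fun i => [set x : flag block | (val x).1 == i]%SET); split.
- apply/setP => x; rewrite !inE; apply/bigcupP; exists (val x).1 => //.
  by rewrite inE.
- move=> i j neq_ij; rewrite -setI_eq0; apply/eqP/setP => x; rewrite !inE.
  by case: eqP => // ->; rewrite (negPf neq_ij).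
- move=> i; apply: leq_trans (dB i).
  have snd_inj : {in [set x : flag block | (val x).1 == i]%SET &,
      injective (fun x => (val x).2)}.
    move=> x y; rewrite !inE => /eqP xi /eqP yi eq_xy; apply: val_inj.
    by rewrite [val x]surjective_pairing [val y]surjective_pairing xi yi eq_xy.
  rewrite -(card_in_imset snd_inj) -big_mkcond sum1_card.
  apply/subset_leq_card/fintype.subsetP => _ /imsetP[x + ->].
  by rewrite !inE => /eqP <-; apply: (valP x).
- move=> i j neq_ij; have [b /andP[ib jb]] := pB i j neq_ij.
  pose x : flag block := exist _ (i, b) ib.
  pose y : flag block := exist _ (j, b) jb.
  by exists x, y; rewrite !inE /= /flag_adj /= !eqxx.
Qed.

Theorem theorem1p8 (R : realType) (t : nat) (H : sgraph)
  (ht : (2 <= t)%N) (Hconn : connected_graph H) (Hcard : (t < #|H|)%N) :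
  exists o : nat -> R,
    (o @ \oo --> (0 : R)) /\
    \forall r \near \oo,
      exists2 k : nat, f_is r H k &
        (k%:R : R) <= (1 + o r) * ((r%:R - 1) / (t%:R - 1)).
Proof.
pose P r k := `[< free_rk_graph_exists r k H >].
(* The default 0 is never reached where [f_spec] applies. *)
pose f r := if pselect (exists k, P r k) is left e then ex_minn e else 0%N.
have f_spec r k : (0 < r)%N -> (0 < k)%N -> pair_cover t 'I_r k ->
    f_is r H (f r) /\ (f r <= k)%N.
  move=> r0 k0 /(pair_cover_free_rk_graph Hconn Hcard r0 k0) ex_k.
  rewrite /f; case: pselect => [e|[]]; last by exists k; apply/asboolP.
  case: ex_minnP => n /asboolP ex_n min_n; split; last exact/min_n/asboolP.
  by split=> // k' ex_k'; apply/min_n/asboolP.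
have t1_gt0 : 0 < t%:R - 1 :> R by rewrite subr_gt0 (ltr_nat R 1).
pose x r : R := (f r)%:R * (t%:R - 1) / (r%:R - 1) - 1.
(* [x r] is the exact relative error, so the inequality holds by construction; truncation at 0
   leaves only an upper bound to prove for the limit. *)
exists (fun r => Num.max 0 (x r)); split; last first.
  have [C C_spec] := pair_cover_asymptotic 1 ht.
  near=> r.
  have r_gt1 : (1 < r)%N by near: r; exact: nbhs_infty_gt.
  have r1_gt0 : 0 < r%:R - 1 :> R by rewrite subr_gt0 (ltr_nat R 1).
  have [k cov_k _] := C_spec r.
  exists (f r).
    (* [k.+1] because part sizes must be positive. *)
    by have [] := f_spec r k.+1 (ltnW r_gt1) isT
      (pair_cover_monotone (leqnSn k) cov_k).
  rewrite mulrA ler_pdivlMr // -ler_pdivrMr // -lerBlDl.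
  by rewrite le_max lexx orbT.
apply/cvgrPdist_le => e e0.
(* The final estimate is [1 + 2/m]: one [1/m] from the cover, one to absorb constants. *)
pose m := Num.bound (2 / e).
have [C C_spec] := pair_cover_asymptotic m ht.
pose N := (C + m * t + m + 3)%N.
near=> r.
have le_Nr : (N <= r)%N by near: r; exact: nbhs_infty_ge.
have [k cov_k le_k] := C_spec r.
have [_ le_f] : f_is r H (f r) /\ (f r <= k.+1)%N.
  apply: f_spec (pair_cover_monotone (leqnSn k) cov_k) => //.
  by apply: leq_trans le_Nr; rewrite /N addnS.
have r1_gt0 : 0 < r%:R - 1 :> R.
  by rewrite subr_gt0 (ltr_nat R 1); apply: leq_trans le_Nr; rewrite /N; lia.
have m_bound : 2 < e * m%:R.
  have : 2 / e < m%:R by apply: archi_boundP; rewrite divr_ge0 // ltW.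
  by rewrite ltr_pdivrMr // mulrC.
have m_gt0 : 0 < m%:R :> R by rewrite -(pmulr_rgt0 _ e0) (lt_trans _ m_bound).
(* One extra [r] absorbs [C], the cost of [k.+1], and the [m.+2] that turns [r] into [r - 1]. *)
have le_nat : (m * t.-1 * f r + m.+2 <= m.+2 * r)%N.
  have : (m * t.-1 * f r <= m * t.-1 * k.+1)%N by rewrite leq_mul2l le_f orbT.
  move: le_Nr; rewrite /N; nia.
have le_R : m%:R * ((t%:R - 1) * (f r)%:R) <= (m%:R + 2) * (r%:R - 1) :> R.
  have : ((m * t.-1 * f r + m.+2)%:R : R) <= (m.+2 * r)%:R by rewrite ler_nat.
  rewrite natrD !natrM -subn1 natrB ?(ltnW ht) // -addn2 natrD; lra.
rewrite sub0r normrN ger0_norm ?le_max ?lexx // ge_max ltW //=.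
rewrite lerBlDr ler_pdivrMr //.
rewrite -(ler_pM2l m_gt0); apply: le_trans (_ : _ <= (m%:R + 2) * (r%:R - 1)) _.
  by rewrite [(f r)%:R * _]mulrC.
rewrite mulrA ler_wpM2r ?(ltW r1_gt0) //; lra.
Unshelve. all: by end_near.
Qed.
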